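(* Let $(V_1,V_2)$ be a pair of commuting isometries on a Hilbert space $\mathcal{H}$. Suppose that $\dim\mathcal{W}_j<\infty$ for some $j\in\{1,2\}$. Then $C(V_1,V_2)\le0$ if and only if $C(V_1,V_2)=0$.
   Context: The defect operator of $(V_1,V_2)$ is the self-adjoint operator $C(V_1,V_2)=I-V_1V_1^*-V_2V_2^*+V_1V_2V_1^*V_2^*$ on $\mathcal{H}$. $\mathcal{W}_j=\mathcal{H}\ominus V_j\mathcal{H}=\ker V_j^*$ for $j=1,2$. *)

(* Defs.v *)
From HB Require Import structures.
From mathcomp Require Import all_boot all_order all_algebra.
From mathcomp Require Import sesquilinear complex.
From mathcomp Require Import all_classical all_reals all_analysis.

Set Implicit Arguments.
Unset Strict Implicit.
Unset Printing Implicit Defensive.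

Import Order.TTheory GRing.Theory Num.Theory Num.Def.
Import numFieldNormedType.Exports.

Local Open Scope classical_set_scope.
Local Open Scope ring_scope.
Local Open Scope complex_scope.

(* Complex Hilbert spaces: complete normed modules over R[i] whose norm comes
   from an inner product. {dot H for conjC} is linear in its first argument and
   conjugate-linear in its second one. *)
HB.mixin Record CompleteNormedModule_isHilbert (R : realType) H
    of CompleteNormedModule R[i] H := {
  inner : {dot H for (@conjC R[i])} ;
  sqr_norm_inner : forall x : H, `|x| ^+ 2 = inner x x
}.

#[short(type="hilbertType")]
HB.structure Definition Hilbert (R : realType) :=
  {H of CompleteNormedModule_isHilbert R H & CompleteNormedModule R[i] H}.

Section HilbertOperators.
Context {R : realType} {H : hilbertType R}.
Implicit Types (T A B V : H -> H) (S : set H) (x y z : H).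

(* The value at y is the vector z, unique if it exists, representing the
   functional x |-> <T x, y>; it exists when T is linear and bounded, by the
   Riesz representation theorem. *)
Definition adjoint T : H -> H :=
  fun y => xget 0 [set z | forall x, inner (T x) y = inner x z].

Definition linear_isometry (V : {linear H -> H}) : Prop :=
  forall x, `|V x| = `|x|.

Definition orthocompl S : set H := [set x | forall y, S y -> inner x y = 0].

Definition wandering V : set H := orthocompl (range V).

(* In R[i], 0 <= z means that z is real and nonnegative. *)
Definition positive_op A : Prop := forall x, 0 <= inner (A x) x.

Definition le_op A B : Prop := positive_op (B - A).

Definition finite_dim S : Prop :=
  exists n (e : 'I_n -> H),
    S = [set x | exists c : 'I_n -> R[i], x = \sum_(i < n) c i *: e i].

Definition defect V1 V2 : H -> H :=
  idfun - (V1 \o adjoint V1) - (V2 \o adjoint V2)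
  + (V1 \o V2 \o adjoint V1 \o adjoint V2).

End HilbertOperators.

(* Main.v *)
Require Import Defs.
From mathcomp Require Import all_boot all_order all_algebra.
From mathcomp Require Import complex sesquilinear ring lra.
From mathcomp Require Import all_classical all_reals all_analysis.

(** The defect operator is a difference of two projections of the same rank:
    writing [P] for the projection [I - V1 V1^*] onto [W1 = ker V1^*],
    commutativity gives [C = P - V2 P V2^*], and [V2 P V2^*] is the projection
    onto [V2 W1].  So [C <= 0] says that [W1] is contained in [V2 W1].  When
    [W1] has finite dimension, [W1] and [V2 W1] have the same dimension, hence they coincide
    and [C = 0].  The operator [C] is symmetric in [V1] and [V2]
    ([defectC]), so finiteness of either wandering subspace suffices.

    The inclusion appears below as [V2 (V2^* x) = x] for [x] in [W1]
    ([le0_fix]): for such [x], [<C x, x> = |x|^2 - |V2^* x|^2] while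
    [|V2 V2^* x - x|^2 = |x|^2 - |V2^* x|^2].  Since [V2^*] preserves [W1],
    every vector of [W1] is the image under [V2] of a vector of [W1], and the
    equality of dimensions becomes [lin_span_stable]: a linear map whose image
    of a finite-dimensional subspace covers that subspace also stabilizes it.
    Then [C x] lies in [W1] for every [x], and it is orthogonal to [W1].

    The adjoint of an isometry [V] exists because [V] has complete range: the
    value at [y] is the [z] such that [V z] is the point of the range nearest
    to [y] ([nearest_in_range]), and [y - V z] is then orthogonal to the range
    ([adjointE]). *)

Set Implicit Arguments.
Unset Strict Implicit.
Unset Printing Implicit Defensive.

Import Order.TTheory GRing.Theory Num.Theory Num.Def.
Import numFieldNormedType.Exports.

Local Open Scope classical_set_scope.
Local Open Scope ring_scope.

Local Notation "''[' u , v ]" := (inner u%R v%R) : ring_scope.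
Local Notation "''[' u ]" := '[u, u] : ring_scope.

(** * Finite-dimensional subspaces *)

Section FiniteSpan.
Context {F : fieldType} {U : lmodType F}.

Definition lin_span n (e : 'I_n -> U) : set U :=
  [set x | exists c : 'I_n -> F, x = \sum_(i < n) c i *: e i].

(** A vector with a nonzero coefficient in a linear relation is a combination
    of the others, so dropping it leaves the span unchanged. *)
Lemma lin_span_reduce n (e : 'I_n.+1 -> U) (c : 'I_n.+1 -> F) k :
  \sum_(i < n.+1) c i *: e i = 0 -> c k != 0 ->
  lin_span (fun i => e (lift k i)) = lin_span e.
Proof.
move=> c0 ck; have sumk (b : 'I_n.+1 -> F) :
    \sum_(i < n.+1) b i *: e i =
    b k *: e k + \sum_(i < n) b (lift k i) *: e (lift k i).
  by rewrite (bigD1_ord k).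
apply/seteqP; split=> x /= [b ->].
  exists (fun i => oapp b 0 (unlift k i)).
  rewrite sumk unlift_none scale0r add0r.
  by apply: eq_bigr => i _; rewrite liftK.
exists (fun i => b (lift k i) - b k / c k * c (lift k i)).
rewrite sumk; have : c k *: e k = - \sum_(i < n) c (lift k i) *: e (lift k i).
  by apply/eqP; rewrite -addr_eq0 -sumk c0.
move=> /(congr1 ( *:%R (b k / c k))); rewrite scalerA mulfVK // => ->.
rewrite scalerN scaler_sumr addrC -sumrB.
by apply: eq_bigr => i _; rewrite scalerBl scalerA.
Qed.

Lemma lin_span_free n (e : 'I_n -> U) : exists m (f : 'I_m -> U),
  lin_span f = lin_span e /\
  forall c : 'I_m -> F, \sum_(i < m) c i *: f i = 0 -> forall i, c i = 0.
Proof.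
elim: n e => [|n IHn] e; first by exists 0, e; split=> // c _ [].
have [free_e|] := pselect (forall c : 'I_n.+1 -> F,
    \sum_(i < n.+1) c i *: e i = 0 -> forall i, c i = 0).
  by exists n.+1, e.
move=> /existsNP[c /not_implyP[c0 /existsNP[k /eqP ck]]].
have [m [f [fe free_f]]] := IHn (fun i => e (lift k i)).
by exists m, f; rewrite fe (lin_span_reduce c0 ck).
Qed.

(** On a basis [f] of the span, the hypothesis reads [f = A (V f)] for a square
    matrix [A].  As [f] is free, [A] has trivial left kernel, so it is
    invertible and [V f = A^-1 f] lies in the span. *)
Lemma lin_span_stable n (e : 'I_n -> U) (V : {linear U -> U}) :
  (forall x, lin_span e x -> exists2 u, lin_span e u & V u = x) ->
  forall x, lin_span e x -> lin_span e (V x).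
Proof.
have [m [f [<- free_f]]] := lin_span_free e => surjV.
have inf i : lin_span f (f i).
  exists (fun j => (j == i)%:R); rewrite (bigD1 i) //= eqxx scale1r.
  by rewrite big1 ?addr0 // => j /negPf ->; rewrite scale0r.
have /choice[a fa] i : exists a : 'I_m -> F, f i = \sum_(j < m) a j *: V (f j).
  have [u [a ->] <-] := surjV _ (inf i).
  by exists a; rewrite linear_sum; apply: eq_bigr => j _; rewrite linearZ.
pose A : 'M[F]_m := \matrix_(i, j) a i j.
have comb (v : 'rV[F]_m) :
    \sum_i v 0 i *: f i = \sum_j (v *m A) 0 j *: V (f j).
  under eq_bigr do rewrite fa scaler_sumr.
  rewrite exchange_big; apply: eq_bigr => j _ /=.
  rewrite mxE scaler_suml; apply: eq_bigr => i _.
  by rewrite mxE scalerA.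
have unitA : A \in unitmx.
  rewrite unitmxE unitfE; apply/det0P => -[v v0 vA].
  case/eqP: v0; apply/rowP => i; rewrite mxE.
  apply: (free_f (v 0)); rewrite comb vA big1 // => j _.
  by rewrite mxE scale0r.
move=> _ [c ->]; exists ((\row_i c i *m invmx A) 0).
rewrite comb mulmxKV // linear_sum.
by apply: eq_bigr => j _; rewrite mxE linearZ.
Qed.

End FiniteSpan.

(** * Isometries of a Hilbert space and their adjoints *)

Section Hilbert.
Context {R : realType} {H : hilbertType R}.
Implicit Types (x y z : H).

Lemma innerC x y : '[x, y] = ('[y, x])^*.
Proof. by rewrite hermC expr0 mul1r. Qed.

(** Polarization: the real part of an inner product is determined by norms.
    Hence [c d] has zero real part for every scalar [c], where [d] is the
    difference of the two sides; the choice [c = d^*] gives [|d|^2 = 0]. *)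
Lemma isometry_inner (V : {linear H -> H}) : linear_isometry V ->
  forall x y, '[V x, V y] = '[x, y].
Proof.
move=> isoV x y; apply/eqP; rewrite -subr_eq0; set d := _ - _.
have sqV z : '[V z] = '[z] by rewrite -!sqr_norm_inner isoV.
have Hd c : c * d + (c * d)^* = 0.
  have := sqV (c *: x + y).
  rewrite linearP !dnormD sqV.
  have -> : '[c *: V x] = '[c *: x] by rewrite -linearZ sqV.
  move=> /addrI.
  rewrite !linearZl_LR /= /d mulrBr rmorphB /= => E.
  by rewrite addrACA -opprD E subrr.
have := Hd d^*; rewrite mulrC -normCK.
rewrite conj_Creal ?realX ?normr_real // -mulr2n => /eqP.
by rewrite mulrn_eq0 /= sqrf_eq0 normr_eq0.
Qed.

Lemma parallelogram x y :
  `|x + y| ^+ 2 + `|x - y| ^+ 2 = 2%:R * (`|x| ^+ 2 + `|y| ^+ 2).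
Proof. by rewrite !sqr_norm_inner dnormD dnormB /=; ring. Qed.

(** The norm of [H] takes values in [R[i]]; infima are taken in [R]. *)
Let rnorm x : R := complex.Re `|x|.

Let rnormE x : `|x| = real_complex R (rnorm x).
Proof. by rewrite RRe_real ?normr_real. Qed.

Let rnorm_ge0 x : 0 <= rnorm x.
Proof. by rewrite -ler0c -rnormE. Qed.

(** A minimizing sequence [V (u n)] for the distance to [y] is Cauchy by the
    parallelogram identity, because midpoints stay in the range.  As [V] is
    isometric, [u] itself is Cauchy, and its limit is a minimizer. *)
Lemma nearest_in_range (V : {linear H -> H}) (y : H) : linear_isometry V ->
  exists z, forall x, `|y - V z| <= `|y - V x|.
Proof.
move=> isoV.
have [D leD nearD] : exists2 D : R, forall z, D <= rnorm (y - V z) &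
    forall e, 0 < e -> exists z, rnorm (y - V z) < D + e.
  pose E := [set rnorm (y - V z) | z in [set: H]].
  have infE : has_inf E.
    by split; [exists (rnorm (y - V 0)), 0 | exists 0 => _ [z _ <-]].
  exists (inf E) => [z|e e0]; first by apply: ge_inf; [case: infE | exists z].
  by have [_ [z _ <-] ltz] := inf_adherent e0 infE; exists z.
have D_ge0 : 0 <= D.
  rewrite leNgt; apply/negP => D0; have [|z] := nearD (- D); first by lra.
  by rewrite subrr; apply/negP; rewrite -leNgt.
have /choice[u uD] (n : nat) : exists z, rnorm (y - V z) < D + n.+1%:R^-1.
  by apply: nearD; rewrite invr_gt0.
have close n k : rnorm (u n - u k) ^+ 2 <=
    2 * ((D + n.+1%:R^-1) ^+ 2 + (D + k.+1%:R^-1) ^+ 2) - 4 * D ^+ 2.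
  have := parallelogram (y - V (u k)) (y - V (u n)).
  have -> : y - V (u k) - (y - V (u n)) = V (u n - u k).
    by rewrite [in RHS]linearB /= opprB [LHS]addrC subrKA.
  have -> : y - V (u k) + (y - V (u n)) =
      2%:R *: (y - V (2%:R^-1 *: (u k + u n))).
    rewrite scalerBr -linearZ /= scalerA divff ?pnatr_eq0 // scale1r linearD /=.
    by rewrite scaler_nat mulr2n addrACA opprD.
  set m := 2%:R^-1 *: _.
  rewrite isoV normrZ normr_nat !rnormE.
  rewrite -[2%:R](rmorph_nat (real_complex R)) -!rmorphM -!rmorphXn.
  rewrite -!rmorphD -rmorphM.
  move=> /complexI.
  have ltE i : rnorm (y - V (u i)) ^+ 2 <= (D + i.+1%:R^-1) ^+ 2.
    rewrite lerXn2r ?nnegrE ?rnorm_ge0 ?addr_ge0 ?invr_ge0 ?ler0n //.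
    exact: ltW.
  have Da : D ^+ 2 <= rnorm (y - V m) ^+ 2.
    by rewrite lerXn2r ?nnegrE.
  move=> E4.
  have {}E4 : 4 * rnorm (y - V m) ^+ 2 + rnorm (u n - u k) ^+ 2 =
      2 * (rnorm (y - V (u k)) ^+ 2 + rnorm (y - V (u n)) ^+ 2).
    by rewrite -E4 exprMn; congr (_ * _ + _); ring.
  have := ltE n; have := ltE k.
  by move: n.+1%:R^-1 k.+1%:R^-1 => s t; lra.
have cu : cvg (u @ \oo).
  apply: cauchy_cvg; apply/cauchyP => eps eps0.
  have epsE : eps = real_complex R (complex.Re eps).
    by rewrite RRe_real ?gtr0_real.
  have e0 : 0 < complex.Re eps by rewrite -ltcR -epsE.
  set e := complex.Re eps in epsE e0.
  (* The gap 2 ((D + s)^2 + (D + t)^2) - 4 D^2 = 4 D (s + t) + 2 (s^2 + t^2)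
     is at most (8 D + 4) del when s and t are at most del <= 1. *)
  pose del := Num.min 1 (e ^+ 2 / (8 * D + 5)).
  have den0 : 0 < 8 * D + 5 by lra.
  have del0 : 0 < del by rewrite lt_min ltr01 divr_gt0 ?exprn_gt0.
  have del1 : del <= 1 by rewrite ge_min lexx.
  have dele : del * (8 * D + 5) <= e ^+ 2.
    by rewrite -ler_pdivlMr // ge_min lexx orbT.
  have [N _ Ndel] := near_infty_natSinv_lt (PosNum del0).
  exists (u N); exists N => // n /= Nn.
  rewrite -ball_normE /= rnormE epsE ltcR -(ltr_pXn2r (ltn0Sn 1)) ?nnegrE //;
    last exact: ltW.
  apply: le_lt_trans (close _ _) _.
  have := Ndel N (leqnn N); have := Ndel n Nn; rewrite /=.
  have := invr_ge0 (N.+1%:R : R); have := invr_ge0 (n.+1%:R : R).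
  rewrite !ler0n.
  set s := _^-1; set t := _^-1 => s0 t0 sd td.
  have ss : s ^+ 2 <= del by rewrite expr2; nra.
  have tt : t ^+ 2 <= del by rewrite expr2; nra.
  nra.
exists (lim (u @ \oo)) => x; rewrite !rnormE lecR.
apply: le_trans (leD x).
apply/ler_addgt0Pl => e e0.
have e20 : 0 < e / 2 by rewrite divr_gt0.
have eC : 0 < real_complex R (e / 2) by move: e20; rewrite -ltcR.
have [N1 _ HN1] := cvgr_dist_lt _ _ cu _ eC.
have [N2 _ HN2] := near_infty_natSinv_lt (PosNum e20).
pose n := maxn N1 N2.
have := HN1 n (leq_maxl _ _); have := HN2 n (leq_maxr _ _); have := uD n.
rewrite /= distrC rnormE ltcR => lt1 lt2 lt3.
have tri : rnorm (y - V (lim (u @ \oo))) <=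
    rnorm (y - V (u n)) + rnorm (u n - lim (u @ \oo)).
  have : `|y - V (lim (u @ \oo))| <= `|y - V (u n)| + `|u n - lim (u @ \oo)|.
    rewrite -(isoV (u n - _)) linearB /= -{1}(subrKA (V (u n)) y).
    exact: ler_normD.
  by rewrite !rnormE -rmorphD lecR.
by move: lt1 lt2; move: n.+1%:R^-1 => s; lra.
Qed.

(** The residual [r = y - V z] at the nearest point is orthogonal to the range:
    otherwise subtracting from [r] its component along [V x] would shorten
    it.  Hence [<V x, y> = <V x, V z> = <x, z>]. *)
Lemma adjointE (V : {linear H -> H}) : linear_isometry V ->
  forall x y, '[V x, y] = '[x, adjoint V y].
Proof.
move=> isoV x y; move: x; rewrite /adjoint.
apply: (@xgetPex _ 0 [set z | forall x, '[V x, y] = '[x, z]]).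
have [z zmin] := nearest_in_range y isoV.
exists z => x; rewrite -[RHS](isometry_inner isoV).
apply/eqP; rewrite -subr_eq0 -linearBr; set r := y - V z.
have [->|x0] := eqVneq x 0; first by rewrite linear0 linear0l.
have Vx0 : 0 < '[V x] by rewrite (isometry_inner isoV) dnorm_gt0.
have rmin : '[r] <= '[r - ('[r, V x] / '[V x]) *: V x].
  rewrite -!sqr_norm_inner lerXn2r ?nnegrE //.
  by rewrite /r -addrA -opprD -linearZ /= -linearD; exact: zmin.
move: r rmin => r; rewrite dnormB dnormZ linearZr_LR /=.
set d := '[r, V x]; set w := '[V x] in Vx0 *.
have wC : w^* = w by rewrite conj_Creal ?gtr0_real.
have -> : (d / w)^* * d = `|d| ^+ 2 / w.
  by rewrite fmorph_div /= wC normCK; ring.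
have w0 : w != 0 by rewrite gt_eqF.
have -> : `|d / w| ^+ 2 * w = `|d| ^+ 2 / w.
  rewrite normrM normfV (gtr0_norm Vx0); field.
  exact: w0.
rewrite (_ : (`|d| ^+ 2 / w)^* = `|d| ^+ 2 / w); last first.
  by rewrite conj_Creal // realM ?realX ?normr_real // realV gtr0_real.
rewrite opprD addrA addrK -subr_ge0 addrAC subrr add0r oppr_ge0.
rewrite pmulr_lle0 ?invr_gt0 // => d0.
have : `|d| ^+ 2 == 0 by rewrite eq_le d0 exprn_ge0.
rewrite sqrf_eq0 normr_eq0 => /eqP d00.
by rewrite innerC -/d d00 conjC0.
Qed.

Lemma inner_ext x y : (forall z, '[z, x] = '[z, y]) -> x = y.
Proof.
move=> /(_ (x - y)) /eqP; rewrite -subr_eq0 -linearBr dnorm_eq0 subr_eq0.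
by move/eqP.
Qed.

Lemma wanderingP (V : {linear H -> H}) x :
  wandering V x <-> forall y, '[V y, x] = 0.
Proof.
split=> [Wx y|Wx _ [y _ <-]]; last by rewrite innerC Wx conjC0.
by rewrite innerC Wx ?conjC0.
Qed.

Lemma wanderingB (V : {linear H -> H}) x y :
  wandering V x -> wandering V y -> wandering V (x - y).
Proof.
move=> /wanderingP Wx /wanderingP Wy; apply/wanderingP => z.
by rewrite linearBr /= Wx Wy subrr.
Qed.

Lemma sub_range_wandering (V : {linear H -> H}) x : linear_isometry V ->
  wandering V (x - V (adjoint V x)).
Proof.
move=> isoV; apply/wanderingP => y.
by rewrite linearBr /= (isometry_inner isoV) adjointE // subrr.
Qed.

Lemma adjoint_comm (V1 V2 : {linear H -> H}) :
  linear_isometry V1 -> linear_isometry V2 -> (forall x, V1 (V2 x) = V2 (V1 x)) ->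
  forall x, adjoint V1 (adjoint V2 x) = adjoint V2 (adjoint V1 x).
Proof.
move=> iso1 iso2 commV x; apply: inner_ext => z.
by rewrite -!adjointE // commV.
Qed.

(** * The defect operator *)

Section Pair.
Context (V1 V2 : {linear H -> H}).
Context (isoV1 : linear_isometry V1) (isoV2 : linear_isometry V2).
Context (commV : forall x, V1 (V2 x) = V2 (V1 x)).

Lemma defectE x : defect V1 V2 x =
  x - V1 (adjoint V1 x) - V2 (adjoint V2 x)
  + V1 (V2 (adjoint V1 (adjoint V2 x))).
Proof. by []. Qed.

(** The two terms of [C] that begin with [V1] are invisible from [W1], and so
    only [I - V2 V2^*] contributes. *)
Lemma inner_defect_wandering x w : wandering V1 w ->
  '[defect V1 V2 x, w] = '[x, w] - '[adjoint V2 x, adjoint V2 w].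
Proof.
move=> /wanderingP Ww.
by rewrite defectE linearDl !linearBl /= !Ww addr0 subr0 adjointE.
Qed.

Lemma adjoint_wandering x : wandering V1 x -> wandering V1 (adjoint V2 x).
Proof.
move=> /wanderingP Wx; apply/wanderingP => y.
by rewrite -adjointE // -commV.
Qed.

(** The condition [C <= 0] bounds [|x|] by [|V2^* x|] on [W1], which forces the
    distance from [x] to its projection [V2 V2^* x] to vanish. *)
Lemma le0_fix x : le_op (defect V1 V2) 0 -> wandering V1 x ->
  V2 (adjoint V2 x) = x.
Proof.
move=> /(_ x) Cle0 Wx; apply/eqP; rewrite -subr_eq0 -(dnorm_eq0 inner).
rewrite eq_le dnorm_ge0 andbT dnormB (isometry_inner isoV2) adjointE //.
rewrite [X in _ - (_ + X)]conj_Creal ?ger0_real ?dnorm_ge0 //.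
have : 0 <= '[0 - defect V1 V2 x, x] := Cle0.
rewrite sub0r linearNl /= inner_defect_wandering //.
rewrite opprB subr_ge0 => le.
by rewrite opprD addrA ['[_] + _]addrC addrK subr_le0.
Qed.

(** Since [V2] maps [W1] into itself, [C x = P x - V2 P V2^* x] belongs to [W1],
    where [V2 V2^*] is the identity; so [<C x, w> = 0] for every [w] in [W1],
    in particular for [w = C x]. *)
Lemma defect_le0_eq0 : finite_dim (wandering V1) ->
  le_op (defect V1 V2) 0 -> defect V1 V2 = 0.
Proof.
move=> [n [e We]] Cle0.
have V2W x : wandering V1 x -> wandering V1 (V2 x).
  rewrite We; apply: lin_span_stable => {}x; rewrite -[lin_span e]We => Wx.
  by exists (adjoint V2 x); [exact: adjoint_wandering | exact: le0_fix].
apply/funext => x; have WC : wandering V1 (defect V1 V2 x).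
  have -> : defect V1 V2 x = (x - V1 (adjoint V1 x)) -
      V2 (adjoint V2 x - V1 (adjoint V1 (adjoint V2 x))).
    by rewrite defectE linearB /= commV opprB addrA addrAC.
  apply: wanderingB; first exact: sub_range_wandering.
  exact/V2W/sub_range_wandering.
apply/eqP; rewrite -(dnorm_eq0 inner) inner_defect_wandering //.
by rewrite [X in _ - X]innerC -adjointE // le0_fix // -innerC subrr.
Qed.
End Pair.

Lemma defectC (V1 V2 : {linear H -> H}) :
  linear_isometry V1 -> linear_isometry V2 -> (forall x, V1 (V2 x) = V2 (V1 x)) ->
  defect V1 V2 = defect V2 V1.
Proof.
move=> iso1 iso2 commV; apply/funext => x.
rewrite !defectE commV (adjoint_comm iso1 iso2 commV).
by congr (_ + _); rewrite addrAC.
Qed.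
End Hilbert.

Theorem theorem6p7 (R : realType) (H : hilbertType R) (V1 V2 : {linear H -> H})
    (isoV1 : linear_isometry V1) (isoV2 : linear_isometry V2)
    (commV : forall x : H, V1 (V2 x) = V2 (V1 x))
    (dimW : finite_dim (wandering V1) \/ finite_dim (wandering V2)) :
  le_op (defect V1 V2) 0 <-> defect V1 V2 = 0.
Proof.
split=> [Cle0|-> x]; last by rewrite subrr linear0l.
case: dimW => dimW; first exact: defect_le0_eq0.
rewrite defectC //; apply: defect_le0_eq0 => //.
by rewrite defectC.
Qed.
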